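(* The closure operator of a measurable matroid satisfies the closure axioms (CL1)–(CL5). Conversely, if $(J,\Sigma,\mu)$ is a standard measure space and $\mathrm{cl}\colon\Sigma\to\Sigma$ satisfies the closure axioms (CL1)–(CL5), then the family $\mathcal F$ of $\mathrm{cl}$-independent sets, $$\mathcal F=\{F\in\Sigma\mid \mu(X\setminus\mathrm{cl}(F\setminus X))>0\text{ for every }X\subseteq F\text{ with }\mu(X)>0\},$$ satisfies the independence axioms (I1)–(I4), and $(J,\Sigma,\mu,\mathcal F)$ is a measurable matroid with $\mathrm{cl}$ as its closure operator.
   Context: A standard measure space $(J,\Sigma,\mu)$ is a standard Borel space $(J,\Sigma)$ with a finite atomless measure $\mu\colon\Sigma\to[0,\infty)$. Convention: measurable sets are identified when they differ by a $\mu$-null set: $A=B$ means $\mu(A\triangle B)=0$, $A\subseteq B$ means $\mu(A\setminus B)=0$, and families of measurable sets, and maps $\Sigma\to\Sigma$, are understood in the measure algebra. All sets are assumed measurable. A set $X$ in a family $\mathcal X$ is maximal in $\mathcal X$ if $X\subseteq Y\in\mathcal X$ implies $Y\subseteq X$. Write $\mathcal X|Z=\{X\in\mathcal X\mid X\subseteq Z\}$. Independence axioms for $\mathcal F\subseteq\Sigma$: (I1) $\emptyset\in\mathcal F$; (I2) $F_1\subseteq F_2\in\mathcal F$ implies $F_1\in\mathcal F$; (I3) for all $X\in\Sigma$ and all maximal $F_1,F_2\in\mathcal F|X$, $\mu(F_1)=\mu(F_2)$; (I4) if $(F_i)_{i\in\mathbb N}$ is an increasing sequence in $\mathcal F$,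 then $\bigcup_i F_i\in\mathcal F$. A measurable matroid is a tuple $(J,\Sigma,\mu,\mathcal F)$ with $(J,\Sigma,\mu)$ a standard measure space and $\mathcal F$ satisfying (I1)–(I4). Its rank function is $r(X)=\mu(F)$ for any maximal $F\in\mathcal F|X$ (such $F$ exists and the value does not depend on the choice). Its closure operator assigns to $X\in\Sigma$ the unique maximal set $\mathrm{cl}(X)$ in $\{A\in\Sigma\mid X\subseteq A,\ r(A)=r(X)\}$ (it exists). For a map $\mathrm{cl}\colon\Sigma\to\Sigma$, a set $F\in\Sigma$ is $\mathrm{cl}$-independent if $\mu(X\setminus\mathrm{cl}(F\setminus X))>0$ for every $X\subseteq F$ with $\mu(X)>0$. Closure axioms for $\mathrm{cl}$: (CL1) $X\subseteq\mathrm{cl}(X)$ for every $X\in\Sigma$; (CL2) $X\subseteq Y$ implies $\mathrm{cl}(X)\subseteq\mathrm{cl}(Y)$; (CL3) $\mathrm{cl}(\mathrm{cl}(X))=\mathrm{cl}(X)$ for every $X\in\Sigma$; (CL4) if $F$ is $\mathrm{cl}$-independent and $F\subseteq\mathrm{cl}(A)$, then $\mu(F)\le\mu(A)$; (CL5) if $F$ is $\mathrm{cl}$-independent and $\mu(A\setminus\mathrm{cl}(F))>0$, then there exists $H\subseteq A\setminus\mathrm{cl}(F)$ with $\mu(H)>0$ such that $F\cup H$ is $\mathrm{cl}$-independent. *)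

(* Defs.v *)
From HB Require Import structures.
From mathcomp Require Import all_boot all_order all_algebra.
From mathcomp Require Import all_classical all_reals all_analysis.

Set Implicit Arguments.
Unset Strict Implicit.
Unset Printing Implicit Defensive.

Local Open Scope classical_set_scope.
Local Open Scope ring_scope.
Local Open Scope ereal_scope.

(** [J] is Borel isomorphic to a complete separable metric space, i.e. its
    sigma-algebra is the Borel sigma-algebra of a Polish topology.
    ([metricType] carries no completeness and no base point.) *)
Definition standard_borel (R : realType) (d : measure_display)
    (J : measurableType d) : Prop :=
  exists (T : metricType R) (f : J -> T),
    [/\ forall G : set_system T, ProperFilter G -> cauchy G ->
          exists x : T, G --> x,
        exists2 D : set T, countable D & dense D,
        bijective f &
        forall A : set J, measurable A <->
          exists2 B : set T, <<s open >> B & A = f @^-1` B].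

Section MeasurableMatroid.
Context {R : realType} {d : measure_display} {J : measurableType d}.
Variable mu : {finite_measure set J -> \bar R}.

Definition atomless : Prop :=
  forall A : set J, measurable A -> 0 < mu A ->
    exists B : set J, [/\ measurable B, B `<=` A, 0 < mu B & mu B < mu A].

Definition standard_measure_space : Prop := standard_borel R J /\ atomless.

(** Elements of the measure algebra are represented by measurable sets, to
    be compared with [sub_mod0] and [eq_mod0]. *)

Definition sub_mod0 (A B : set J) : Prop := mu (A `\` B) = 0.

Definition eq_mod0 (A B : set J) : Prop := mu (A `+` B) = 0.

Definition mod0_family (F : set (set J)) : Prop :=
  F `<=` measurable /\
  forall A B : set J, measurable A -> measurable B -> eq_mod0 A B ->
    F A -> F B.

(** Values of [cl] outside of [measurable] are irrelevant. *)
Definition mod0_map (cl : set J -> set J) : Prop :=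
  (forall A : set J, measurable A -> measurable (cl A)) /\
  forall A B : set J, measurable A -> measurable B -> eq_mod0 A B ->
    eq_mod0 (cl A) (cl B).

Definition maximal_in (F : set (set J)) (X : set J) : Prop :=
  F X /\ forall Y : set J, F Y -> sub_mod0 X Y -> sub_mod0 Y X.

Definition restr (F : set (set J)) (Z : set J) : set (set J) :=
  [set X | F X /\ sub_mod0 X Z].

Definition I1 (F : set (set J)) : Prop := F set0.

Definition I2 (F : set (set J)) : Prop :=
  forall F1 F2 : set J, measurable F1 -> sub_mod0 F1 F2 -> F F2 -> F F1.

Definition I3 (F : set (set J)) : Prop :=
  forall X F1 F2 : set J, measurable X ->
    maximal_in (restr F X) F1 -> maximal_in (restr F X) F2 -> mu F1 = mu F2.

Definition I4 (F : set (set J)) : Prop :=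
  forall Fn : nat -> set J, (forall i, F (Fn i)) ->
    (forall i, sub_mod0 (Fn i) (Fn i.+1)) -> F (\bigcup_i Fn i).

Definition independence_axioms (F : set (set J)) : Prop :=
  mod0_family F /\ [/\ I1 F, I2 F, I3 F & I4 F].

Definition measurable_matroid (F : set (set J)) : Prop :=
  standard_measure_space /\ independence_axioms F.

(** [rank] and [matroid_cl] select an object with the defining property;
    the default value [set0] is irrelevant for a measurable matroid, where
    such objects exist. *)
Definition rank (F : set (set J)) (X : set J) : \bar R :=
  mu (xget set0 (maximal_in (restr F X))).

Definition same_rank_supersets (F : set (set J)) (X : set J) :
    set (set J) :=
  [set A | [/\ measurable A, sub_mod0 X A & rank F A = rank F X]].

Definition matroid_cl (F : set (set J)) (X : set J) : set J :=
  xget set0 [set C | maximal_in (same_rank_supersets F X) C /\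
    forall C' : set J, maximal_in (same_rank_supersets F X) C' ->
      eq_mod0 C' C].

Definition cl_independent (cl : set J -> set J) : set (set J) :=
  [set F | measurable F /\
    forall X : set J, measurable X -> sub_mod0 X F -> 0 < mu X ->
      0 < mu (X `\` cl (F `\` X))].

Definition CL1 (cl : set J -> set J) : Prop :=
  forall X : set J, measurable X -> sub_mod0 X (cl X).

Definition CL2 (cl : set J -> set J) : Prop :=
  forall X Y : set J, measurable X -> measurable Y ->
    sub_mod0 X Y -> sub_mod0 (cl X) (cl Y).

Definition CL3 (cl : set J -> set J) : Prop :=
  forall X : set J, measurable X -> eq_mod0 (cl (cl X)) (cl X).

Definition CL4 (cl : set J -> set J) : Prop :=
  forall F A : set J, cl_independent cl F -> measurable A ->
    sub_mod0 F (cl A) -> mu F <= mu A.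

Definition CL5 (cl : set J -> set J) : Prop :=
  forall F A : set J, cl_independent cl F -> measurable A ->
    0 < mu (A `\` cl F) ->
    exists H : set J, [/\ measurable H, sub_mod0 H (A `\` cl F), 0 < mu H &
      cl_independent cl (F `|` H)].

Definition closure_axioms (cl : set J -> set J) : Prop :=
  mod0_map cl /\ [/\ CL1 cl, CL2 cl, CL3 cl, CL4 cl & CL5 cl].

End MeasurableMatroid.

(* Main.v *)
Require Import Defs.
From HB Require Import structures.
From mathcomp Require Import all_boot all_order all_algebra.
From mathcomp Require Import all_classical all_reals all_analysis.
From mathcomp Require Import lra.

(** Both directions are the classical correspondence between independent sets
    and closures, carried out in the measure algebra, where countability
    arguments replace finiteness.

    Maximal independent sets (bases) exist inside every measurable set, and
    above every independent subset of it, by exhaustion: a family that is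
    closed under increasing unions has maximal elements, because one can climb
    towards the supremum of the measures and take the union
    ([maximal_in_extend]).

    From independent sets to the closure: extending a basis of [X `&` Y] to one
    of [X `|` Y] shows that the rank is submodular ([rk_submodular]), and
    intersecting a basis of an increasing union with its terms shows that the
    rank is continuous along it ([rk_bigcup_le]).  Hence the supersets of [X]
    of the same rank are closed under binary and increasing countable unions,
    so they have a greatest element, and a set [A] lies in the closure of [X]
    exactly when adding [A] to [X] does not raise the rank
    ([sub_matroid_clP]).  With this criterion CL1, CL2 and CL3 are computations
    with the rank.  It also shows that the sets independent for the closure
    are the original ones ([cl_independentE]), after which CL4 follows from
    [mass A = rk A <= rk X <= mass X] and CL5 by extending a basis.

    From a closure to independent sets: by CL5 a maximal independent subset [B]
    of [X] spans it ([basis_spans]), so that CL4 compares any two of them.  The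
    axiom about increasing unions also comes from CL4: if the union [U] of
    independent [An] were dependent, some [X] of positive measure would be
    spanned by [U `\` X]; then [U `\` X] spans every [An], so
    [mass An <= mass U - mass X] for all [n], although [mass An] tends to
    [mass U].  Finally the original [cl X] has the rank of [X] by CL4, and it
    contains every superset of [X] of that rank since a basis of [X] is also a
    basis of such a superset ([matroid_cl_recovers]). *)

Set Implicit Arguments.
Unset Strict Implicit.
Unset Printing Implicit Defensive.

Import Order.TTheory GRing.Theory Num.Theory.

Local Open Scope classical_set_scope.
Local Open Scope ring_scope.
Local Open Scope ereal_scope.

(** * Inclusion up to null sets and exhaustion *)

Ltac solve_measurable :=
  repeat first [ assumption
    | apply: measurableT | apply: measurable0 | apply: measurableU
    | apply: measurableI | apply: measurableD | apply: measurableC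
    | apply: bigcup_measurable => ? ? | solve [auto] ].

Section MeasureAlgebra.
Context {R : realType} {d : measure_display} {J : measurableType d}.
Variable mu : {finite_measure set J -> \bar R}.
Implicit Types A B C X Y : set J.

(** All measures are finite; real values make subtraction, and hence linear
    arithmetic, available. *)
Definition mass A : R := fine (mu A).

Lemma muE A : measurable A -> mu A = (mass A)%:E.
Proof. by move=> mA; rewrite /mass fineK ?fin_num_measure. Qed.

Lemma mass_ge0 A : measurable A -> (0 <= mass A)%R.
Proof. by move=> mA; rewrite -lee_fin -muE. Qed.

Lemma mass_split A B : measurable A -> measurable B ->
  mass A = (mass (A `&` B) + mass (A `\` B))%R.
Proof.
move=> mA mB; apply: EFin_inj.
by rewrite EFinD -!muE; [rewrite addeC -measureDI|solve_measurable..].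
Qed.

(** Inclusions modulo null sets combine like implications that hold almost
    everywhere; this is how set algebra is done throughout. *)
Lemma sub_mod0_ae A B : measurable A -> measurable B ->
  sub_mod0 mu A B <-> \forall x \ae mu, A x -> B x.
Proof.
move=> mA mB; rewrite /sub_mod0 -(negligibleP mu); last by solve_measurable.
suff -> : A `\` B = ~` [set x | A x -> B x] by [].
by rewrite predeqE => x /=; rewrite not_implyE.
Qed.

Lemma eq_mod0_sub A B : measurable A -> measurable B ->
  eq_mod0 mu A B <-> sub_mod0 mu A B /\ sub_mod0 mu B A.
Proof.
move=> mA mB; rewrite /eq_mod0 /sub_mod0 /setY; split=> [h|[h1 h2]].
  by split; apply: (subset_measure0 (B := (A `\` B) `|` (B `\` A)));
    solve_measurable.
by apply: null_set_setU => //; solve_measurable.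
Qed.

Lemma sub_mod0_trans B A C : measurable A -> measurable B -> measurable C ->
  sub_mod0 mu A B -> sub_mod0 mu B C -> sub_mod0 mu A C.
Proof.
move=> mA mB mC; rewrite !sub_mod0_ae // => h1 h2.
by apply: filterS2 h1 h2 => x; tauto.
Qed.

Lemma subset_sub_mod0 A B : A `<=` B -> sub_mod0 mu A B.
Proof.
by rewrite /sub_mod0 -setD_eq0 => ->; rewrite measure0.
Qed.

Lemma sub_mod0_bigcup (An : nat -> set J) B : (forall n, measurable (An n)) ->
  measurable B -> (forall n, sub_mod0 mu (An n) B) ->
  sub_mod0 mu (\bigcup_n An n) B.
Proof.
move=> mA mB h; apply/sub_mod0_ae => //; first exact: bigcup_measurable.
have : \forall x \ae mu, forall n, An n x -> B x.
  by apply: ae_foralln => n; apply/sub_mod0_ae.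
by apply: filterS => x hx [n _]; exact: hx.
Qed.

Lemma mass_le A B : measurable A -> measurable B -> sub_mod0 mu A B ->
  (mass A <= mass B)%R.
Proof.
move=> mA mB sAB; rewrite (mass_split mA mB) /mass sAB /= addr0 -lee_fin.
rewrite -/(mass _) -/(mass _) -!muE; solve_measurable.
by apply: le_measure; rewrite ?inE; solve_measurable.
Qed.

(** Finiteness of the measure is essential here.  Exhaustion and rank arguments
    only compare measures; this turns such a comparison into an inclusion. *)
Lemma sub_mod0_rigid A B : measurable A -> measurable B -> sub_mod0 mu A B ->
  (mass B <= mass A)%R -> sub_mod0 mu B A.
Proof.
move=> mA mB sAB leBA; rewrite /sub_mod0 muE; last by solve_measurable.
have /(congr1 fine) : mu (A `\` B) = 0 := sAB.
rewrite -/(mass _) /= => sAB0.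
have := mass_split mA mB; have := mass_split mB mA.
have := @mass_ge0 (B `\` A); rewrite (setIC B A) => /(_ (measurableD mB mA)).
by move=> h1 h2 h3; congr (_%:E); lra.
Qed.

Lemma eq_mod0_mass A B : measurable A -> measurable B -> eq_mod0 mu A B ->
  mass A = mass B.
Proof.
by move=> mA mB /eq_mod0_sub[]// s1 s2; apply/eqP; rewrite eq_le !mass_le.
Qed.

(** Continuity from below.  As the sequence increases only up to null sets, the
    partial unions, which really increase and agree with it almost everywhere,
    take its place. *)
Lemma mass_bigcup_le (An : nat -> set J) (c : R) :
  (forall n, measurable (An n)) ->
  (forall n, sub_mod0 mu (An n) (An n.+1)) ->
  (forall n, (mass (An n) <= c)%R) -> (mass (\bigcup_n An n) <= c)%R.
Proof.
move=> mA sA leA; rewrite -bigcup_bigsetU_bigcup.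
pose Bn n := \big[setU/set0]_(i < n.+1) An i.
have mB n : measurable (Bn n) by exact: bigsetU_measurable.
have sBA n : sub_mod0 mu (Bn n) (An n).
  elim: n => [|n IH]; first by apply: subset_sub_mod0; rewrite /Bn big_ord1.
  rewrite /Bn big_ord_recr -/(Bn n) /=.
  apply/sub_mod0_ae; solve_measurable.
  have /sub_mod0_ae := sub_mod0_trans (mB n) (mA n) (mA n.+1) IH (sA n).
  move=> /(_ (mB _) (mA _)); apply: filterS => x; rewrite /setU /=; tauto.
have ndB : {homo Bn : n m / (n <= m)%N >-> (n <= m)%O}.
  by move=> n m nm; rewrite subsetEset; exact: subset_bigsetU.
have mUB : measurable (\bigcup_n Bn n) by solve_measurable.
have cvgB := @nondecreasing_cvg_mu _ _ _ mu Bn mB mUB ndB.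
rewrite -lee_fin -muE // -(cvg_lim _ cvgB)//.
apply: lime_le; first by apply/cvg_ex; eexists; exact: cvgB.
apply: nearW => n /=; rewrite muE // lee_fin.
by rewrite (le_trans (mass_le _ _ (sBA n))).
Qed.

(** Exhaustion: choose [G n.+1] above [G n] whose measure is within [1 / n.+1]
    of the supremum of the measures of the members above [G n].  A member above
    the union of the sequence is above every [G n], so it has no larger
    measure than the union. *)
Lemma maximal_in_extend (S : set (set J)) A0 : S `<=` measurable -> I4 mu S ->
  S A0 -> exists2 A, maximal_in mu S A & sub_mod0 mu A0 A.
Proof.
move=> mS S4 SA0.
pose above A := [set B | S B /\ sub_mod0 mu A B].
have near_sup (p : nat * set J) : exists B, S p.2 -> above p.2 B /\
    forall C, above p.2 C -> (mass C <= mass B + p.1.+1%:R^-1)%R.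
  case: p => n A /=; have [SA|] := pselect (S A); last by exists A.
  have supA : has_sup (mass @` above A).
    split; first by exists (mass A), A; [split=> //; exact: subset_sub_mod0|].
    exists (mass setT) => _ [B [SB _] <-].
    by apply: mass_le; solve_measurable; exact: subset_sub_mod0.
  have n0 : (0 < n.+1%:R^-1 :> R)%R by rewrite invr_gt0.
  have [_ [B aB <-] ltB] := sup_adherent n0 supA.
  exists B => _; split=> // C aC.
  by rewrite (le_trans (sup_upper_bound supA (imageP _ aC)))// ltW// -ltrBlDr.
have [f fP] := choice near_sup.
pose G := fix G n := if n is k.+1 then f (k, G k) else A0.
have SG n : S (G n) by elim: n => //= n SG; have [[]] := fP (n, G n) SG.
have mG n : measurable (G n) by exact: mS.
have GS n : sub_mod0 mu (G n) (G n.+1) by have [[]] := fP (n, G n) (SG n).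
have mU : measurable (\bigcup_n G n) by solve_measurable.
have GU n : sub_mod0 mu (G n) (\bigcup_n G n).
  by apply: subset_sub_mod0; exact: bigcup_sup.
exists (\bigcup_n G n); last exact: GU 0%N.
split; first exact: S4.
move=> Y SY sUY; have mY := mS _ SY; apply: sub_mod0_rigid => //.
rewrite leNgt; apply/negP => /ltr_add_invr[n]; apply/negP; rewrite -leNgt.
have [_ /(_ Y (conj SY (sub_mod0_trans (mG n) mU mY (GU n) sUY)))] :=
  fP (n, G n) (SG n).
by move=> /le_trans; apply; rewrite lerD2r; exact: mass_le (GU n.+1).
Qed.

End MeasureAlgebra.

(** * Rank and closure of a matroid *)

Section Rank.
Context {R : realType} {d : measure_display} {J : measurableType d}.
Variable mu : {finite_measure set J -> \bar R}.
Variable F : set (set J).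
Hypothesis indF : independence_axioms mu F.
Implicit Types A B C X Y : set J.
Local Notation mass := (mass mu).
Local Notation "A `<~` B" := (sub_mod0 mu A B) (at level 70).

Lemma independent_measurable A : F A -> measurable A.
Proof. by case: indF => -[mF _] _; exact: mF. Qed.
Local Notation indepM := independent_measurable.

Lemma independent_sub A B : measurable A -> A `<~` B -> F B -> F A.
Proof. by case: indF => _ [_ + _ _]; exact. Qed.

Lemma restr_I4 X : measurable X -> I4 mu (restr mu F X).
Proof.
case: indF => _ [_ _ _ F4] mX Fn FX Fi; split.
  by apply: F4 => // i; case: (FX i).
by apply: sub_mod0_bigcup => // n; [apply: indepM|]; case: (FX n).
Qed.

Lemma basis_extend X A : measurable X -> F A -> A `<~` X ->
  exists2 B, maximal_in mu (restr mu F X) B & A `<~` B.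
Proof.
move=> mX FA AX; apply: maximal_in_extend => //; last exact: restr_I4.
by move=> Y [/indepM].
Qed.

Lemma basis_exists X : measurable X ->
  exists B, maximal_in mu (restr mu F X) B.
Proof.
move=> mX; have F0 : F set0 by case: indF => _ [].
by have [B] := basis_extend mX F0 (subset_sub_mod0 mu (sub0set X)); exists B.
Qed.

Lemma rankE X B : measurable X -> maximal_in mu (restr mu F X) B ->
  rank mu F X = (mass B)%:E.
Proof.
move=> mX maxB; rewrite -muE; last by case: maxB => -[/indepM].
case: indF => _ [_ _ F3 _]; apply: (F3 X) => //.
by apply: xgetPex; exists B.
Qed.

Definition rk X : R := fine (rank mu F X).

Lemma rank_EFin X : measurable X -> rank mu F X = (rk X)%:E.
Proof. by move=> mX; have [B /rankE] := basis_exists mX; rewrite /rk => ->. Qed.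

Lemma rk_basis X B : measurable X -> maximal_in mu (restr mu F X) B ->
  rk X = mass B.
Proof. by move=> mX /rankE; rewrite /rk => ->. Qed.

Lemma mass_le_rk X A : measurable X -> F A -> A `<~` X -> (mass A <= rk X)%R.
Proof.
move=> mX FA AX; have [B maxB AB] := basis_extend mX FA AX.
rewrite (rk_basis mX maxB); case: maxB => -[FB _] _.
by apply: mass_le => //; exact: indepM.
Qed.

Lemma rk_le_mass X : measurable X -> (rk X <= mass X)%R.
Proof.
move=> mX; have [B maxB] := basis_exists mX; rewrite (rk_basis mX maxB).
by case: maxB => -[FB BX] _; apply: mass_le => //; exact: indepM.
Qed.

Lemma rk_le X Y : measurable X -> measurable Y -> X `<~` Y ->
  (rk X <= rk Y)%R.
Proof.
move=> mX mY XY; have [B maxB] := basis_exists mX; rewrite (rk_basis mX maxB).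
case: maxB => -[FB BX] _; apply: mass_le_rk => //.
exact: sub_mod0_trans (indepM FB) mX mY BX XY.
Qed.

Lemma rk_independent A : F A -> rk A = mass A.
Proof.
move=> FA; have mA := indepM FA; apply/eqP; rewrite eq_le rk_le_mass //=.
by apply: mass_le_rk => //; exact: subset_sub_mod0.
Qed.

(** A basis [B] of the union that extends a basis [A] of the intersection has
    independent traces on [X] and on [Y]; together these cover [B], and they
    overlap at least in [A]. *)
Lemma rk_submodular X Y : measurable X -> measurable Y ->
  (rk (X `|` Y) + rk (X `&` Y) <= rk X + rk Y)%R.
Proof.
move=> mX mY; have mU := measurableU _ _ mX mY.
have mI := measurableI _ _ mX mY.
have [A maxA] := basis_exists mI; rewrite (rk_basis mI maxA).
case: maxA => -[FA AI] _; have mA := indepM FA.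
have [B maxB AB] : exists2 B, maximal_in mu (restr mu F (X `|` Y)) B & A `<~` B.
  apply: basis_extend => //; apply: sub_mod0_trans AI _ => //.
  by apply: subset_sub_mod0 => x [? _]; left.
rewrite (rk_basis mU maxB); case: maxB => -[FB BU] _; have mB := indepM FB.
have rkB Z : measurable Z -> (mass (B `&` Z) <= rk Z)%R.
  move=> mZ; apply: mass_le_rk => //; last by apply: subset_sub_mod0 => x [].
  apply: independent_sub FB; first by solve_measurable.
  by apply: subset_sub_mod0 => x [].
have leA : (mass A <= mass ((B `&` Y) `&` X))%R.
  apply: mass_le; solve_measurable; move: AB AI; rewrite !sub_mod0_ae //;
    solve_measurable.
  apply: filterS2 => x hB hI Ax; have [] := hI Ax.
  by do 2!split=> //; exact: hB.
have leBX : (mass (B `\` X) <= mass ((B `&` Y) `\` X))%R.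
  apply: mass_le; solve_measurable; move: BU; rewrite !sub_mod0_ae //;
    solve_measurable.
  by apply: filterS => x hB [Bx nX]; have [] := hB Bx.
have := mass_split mu mB mX; have := mass_split mu (measurableI _ _ mB mY) mX.
by move: (rkB _ mX) (rkB _ mY); lra.
Qed.

(** Continuity of the rank: a basis of the union is the increasing union of its
    traces on the [An n], whose measures are bounded by the ranks. *)
Lemma rk_bigcup_le (An : nat -> set J) (c : R) :
  (forall n, measurable (An n)) -> (forall n, An n `<~` An n.+1) ->
  (forall n, (rk (An n) <= c)%R) -> (rk (\bigcup_n An n) <= c)%R.
Proof.
move=> mA sA leA; have mU : measurable (\bigcup_n An n) by solve_measurable.
have [B maxB] := basis_exists mU; rewrite (rk_basis mU maxB).
case: maxB => -[FB BU] _; have mB := indepM FB.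
have mI n : measurable (B `&` An n) by solve_measurable.
have : (mass (\bigcup_n (B `&` An n)) <= c)%R.
  apply: mass_bigcup_le => // n.
    move: (sA n); rewrite !sub_mod0_ae //.
    by apply: filterS => x h [Bx Ax]; split=> //; exact: h.
  apply: le_trans (leA n); apply: mass_le_rk => //.
    by apply: independent_sub FB => //; apply: subset_sub_mod0 => x [].
  by apply: subset_sub_mod0 => x [].
apply: le_trans; apply: mass_le => //; first by solve_measurable.
move: BU; rewrite !sub_mod0_ae //; last by solve_measurable.
by apply: filterS => x h Bx; have [n _ Ax] := h Bx; exists n.
Qed.

Lemma same_rankP X A : measurable X -> measurable A -> X `<~` A ->
  same_rank_supersets mu F X A <-> (rk A <= rk X)%R.
Proof.
move=> mX mA XA; split=> [[_ _]|le]; first by rewrite /rk => ->.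
split=> //; rewrite !rank_EFin //; congr (_%:E).
by apply/eqP; rewrite eq_le le rk_le.
Qed.

(** Submodularity: the intersection still contains [X], so it has at least the
    rank of [X], which leaves at most that rank to the union. *)
Lemma same_rankU X A B : measurable X -> same_rank_supersets mu F X A ->
  same_rank_supersets mu F X B -> same_rank_supersets mu F X (A `|` B).
Proof.
move=> mX sA sB; have [mA XA _] := sA; have [mB XB _] := sB.
have leA := (same_rankP mX mA XA).1 sA; have leB := (same_rankP mX mB XB).1 sB.
have leI : (rk X <= rk (A `&` B))%R.
  apply: rk_le; solve_measurable.
  move: XA XB; rewrite !sub_mod0_ae //; solve_measurable.
  by apply: filterS2 => x hA hB Xx; split; [exact: hA|exact: hB].
apply/same_rankP => //; first by solve_measurable.
  apply: (sub_mod0_trans mX mA) XA _; first by solve_measurable.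
  by apply: subset_sub_mod0 => x; left.
by have := rk_submodular mA mB; lra.
Qed.

Lemma same_rank_I4 X : measurable X -> I4 mu (same_rank_supersets mu F X).
Proof.
move=> mX An sA nA; have mA n : measurable (An n) by case: (sA n).
have mU : measurable (\bigcup_n An n) by solve_measurable.
apply/same_rankP => //.
  have [_ X0 _] := sA 0%N; apply: (sub_mod0_trans mX (mA 0%N) mU) X0 _.
  by apply: subset_sub_mod0; exact: bigcup_sup.
apply: rk_bigcup_le => // n; have [_ Xn _] := sA n.
exact/(same_rankP mX (mA n) Xn).
Qed.

Local Notation cl := (matroid_cl mu F).

Lemma same_rank_max_unique X C C' : measurable X ->
  maximal_in mu (same_rank_supersets mu F X) C ->
  same_rank_supersets mu F X C' -> C' `<~` C.
Proof.
move=> mX [sC maxC] sC'; have [mC _ _] := sC; have [mC' _ _] := sC'.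
have mU := measurableU _ _ mC mC'.
apply: (sub_mod0_trans mC' mU mC); first by apply: subset_sub_mod0 => x; right.
apply: maxC; first exact: same_rankU.
by apply: subset_sub_mod0 => x; left.
Qed.

(** Continuity of the rank provides a maximal superset of the same rank by
    exhaustion, and closure under unions makes it unique, so the set that
    [matroid_cl] selects has the defining property. *)
Lemma matroid_clP X : measurable X ->
  maximal_in mu (same_rank_supersets mu F X) (cl X).
Proof.
move=> mX; pose S := same_rank_supersets mu F X.
have mS : S `<=` measurable by move=> A [].
have SX : S X by apply/same_rankP => //; exact: subset_sub_mod0.
have [C maxC _] := maximal_in_extend mS (same_rank_I4 mX) SX.
suff [] : [set C | maximal_in mu S C /\
    forall C', maximal_in mu S C' -> eq_mod0 mu C' C] (cl X) by [].
apply: xgetPex; exists C; split=> // C' maxC'.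
have [mC mC'] : measurable C /\ measurable C'.
  by split; apply: mS; [case: maxC|case: maxC'].
apply/eq_mod0_sub => //; split; apply: (@same_rank_max_unique X) => //.
  by case: maxC'.
by case: maxC.
Qed.

Lemma matroid_cl_measurable X : measurable X -> measurable (cl X).
Proof. by move=> /matroid_clP[[]]. Qed.

Lemma sub_matroid_cl X : measurable X -> X `<~` cl X.
Proof. by move=> /matroid_clP[[]]. Qed.

Lemma rk_matroid_cl X : measurable X -> rk (cl X) = rk X.
Proof. by move=> /matroid_clP[[_ _ rE] _]; rewrite /rk rE. Qed.

(** The working criterion: the closure collects what can be added without
    raising the rank. *)
Lemma sub_matroid_clP X A : measurable X -> measurable A ->
  A `<~` cl X <-> (rk (X `|` A) <= rk X)%R.
Proof.
move=> mX mA; have mC := matroid_cl_measurable mX.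
have mU := measurableU _ _ mX mA; split=> [AC|leU].
  rewrite -(rk_matroid_cl mX); apply: rk_le => //.
  move: AC (sub_matroid_cl mX); rewrite !sub_mod0_ae //.
  by apply: filterS2 => x hA hX [/hX|/hA].
apply: (sub_mod0_trans mA mU mC); first by apply: subset_sub_mod0 => x; right.
apply: (same_rank_max_unique mX (matroid_clP mX)); apply/same_rankP => //.
by apply: subset_sub_mod0 => x; left.
Qed.

Lemma matroid_cl_mono X Y : measurable X -> measurable Y -> X `<~` Y ->
  cl X `<~` cl Y.
Proof.
move=> mX mY XY; have mC := matroid_cl_measurable mX.
apply/sub_matroid_clP => //.
have leI : (rk X <= rk (Y `&` cl X))%R.
  apply: rk_le => //; first by solve_measurable.
  move: XY (sub_matroid_cl mX); rewrite !sub_mod0_ae //; solve_measurable.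
  by apply: filterS2 => x hY hC Xx; split; [exact: hY|exact: hC].
by have := rk_submodular mY mC; rewrite (rk_matroid_cl mX); lra.
Qed.

Lemma matroid_cl_idem X : measurable X -> cl (cl X) `<~` cl X.
Proof.
move=> mX; have mC := matroid_cl_measurable mX.
have mCC := matroid_cl_measurable mC.
apply: (same_rank_max_unique mX (matroid_clP mX)); apply/same_rankP => //.
  exact: sub_mod0_trans mX mC mCC (sub_matroid_cl mX) (sub_matroid_cl mC).
by rewrite !rk_matroid_cl.
Qed.

(** If [A] is independent for the closure, the part of [A] outside a basis of
    [A] lies in the closure of that basis, hence is null.  Conversely, removing
    a non-null [X] from a member [A] of [F] lowers the rank, so [X] cannot lie
    in the closure of the rest. *)
Lemma cl_independentE : cl_independent mu cl = F.
Proof.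
rewrite predeqE => A; split=> [[mA indA]|FA].
  have [B maxB] := basis_exists mA; have rB := rk_basis mA maxB.
  case: maxB => -[FB BA] _; have mB := indepM FB.
  have mAB : measurable (A `\` B) by solve_measurable.
  have mI : measurable (A `\` (A `\` B)) by solve_measurable.
  (* [A `\` (A `\` B)] is [B] up to a null set *)
  have spanned : A `\` B `<~` cl (A `\` (A `\` B)).
    apply/sub_matroid_clP => //.
    apply: (@le_trans _ _ (rk A)).
      apply: rk_le => //; first by solve_measurable.
      by apply: subset_sub_mod0 => x [[]|[]].
    rewrite rB; apply: mass_le_rk => //.
    move: BA; rewrite !sub_mod0_ae //.
    by apply: filterS => x h Bx; split; [exact: h|case].
  apply: independent_sub FB => //; apply: contrapT => /eqP nAB.
  have := indA _ mAB (subset_sub_mod0 mu (@subDsetl _ _ _)).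
  by rewrite lt0e nAB measure_ge0 /= => /(_ isT); rewrite spanned ltxx.
have mA := indepM FA; split=> // X mX XA X0.
have mD : measurable (A `\` X) by solve_measurable.
rewrite lt0e measure_ge0 andbT; apply/eqP => /(sub_matroid_clP mD mX).
have FD : F (A `\` X).
  by apply: independent_sub FA => //; apply: subset_sub_mod0 => x [].
rewrite (rk_independent FD) leNgt => /negP; apply.
apply: (@lt_le_trans _ _ (mass A)).
  rewrite (mass_split mu mA mX) ltrDr.
  suff -> : mass (A `&` X) = mass X by rewrite -lte_fin -muE.
  apply: eq_mod0_mass; solve_measurable.
  apply/eq_mod0_sub; solve_measurable; split.
    by apply: subset_sub_mod0 => x [].
  move: XA; rewrite !sub_mod0_ae //; solve_measurable.
  by apply: filterS => x h Xx; split=> //; exact: h.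
apply: mass_le_rk => //; first by solve_measurable.
apply: subset_sub_mod0 => x Ax.
by have [Xx|nXx] := pselect (X x); [right|left].
Qed.

Lemma matroid_closure_axioms : closure_axioms mu cl.
Proof.
split; [split; first exact: matroid_cl_measurable|split].
- move=> A B mA mB /eq_mod0_sub[]// AB BA; apply/eq_mod0_sub.
  + exact: matroid_cl_measurable.
  + exact: matroid_cl_measurable.
  + by split; exact: matroid_cl_mono.
- exact: sub_matroid_cl.
- exact: matroid_cl_mono.
- move=> X mX; have mC := matroid_cl_measurable mX.
  have mCC := matroid_cl_measurable mC; apply/eq_mod0_sub => //.
  by split; [exact: matroid_cl_idem|exact: sub_matroid_cl].
- move=> A X; rewrite cl_independentE => FA mX AX; have mA := indepM FA.
  rewrite !muE // lee_fin (le_trans _ (rk_le_mass mX)) // -rk_matroid_cl //.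
  by apply: mass_le_rk => //; exact: matroid_cl_measurable.
- move=> A X; rewrite cl_independentE => FA mX X0; have mA := indepM FA.
  have mC := matroid_cl_measurable mA.
  have mD : measurable (X `\` cl A) by solve_measurable.
  have mU := measurableU _ _ mA mD.
  have [B maxB AB] := basis_extend mU FA (subset_sub_mod0 mu (@subsetUl _ A _)).
  have rB := rk_basis mU maxB; case: maxB => -[FB BU] _; have mB := indepM FB.
  exists (B `\` A); split; first by solve_measurable.
  + move: BU; rewrite !sub_mod0_ae //; solve_measurable.
    by apply: filterS => x h [Bx nA]; have [] := h Bx.
  + rewrite lt0e measure_ge0 andbT; apply/eqP => BA.
    suff AC : X `\` cl A `<~` cl A.
      move: X0; suff -> : mu (X `\` cl A) = 0 by rewrite ltxx.
      by rewrite -AC; congr (mu _); rewrite setDDl setUid.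
    apply/sub_matroid_clP => //; rewrite rB (rk_independent FA).
    exact: mass_le.
  + apply: independent_sub FB.
      by solve_measurable.
    move: AB; rewrite !sub_mod0_ae //; solve_measurable.
    by apply: filterS => x h [/h|[]].
Qed.

End Rank.

(** * The matroid of a closure operator *)

Section ClosureToMatroid.
Context {R : realType} {d : measure_display} {J : measurableType d}.
Variable mu : {finite_measure set J -> \bar R}.
Variable cl : set J -> set J.
Hypothesis clA : closure_axioms mu cl.
Implicit Types A B C X Y : set J.
Local Notation mass := (mass mu).
Local Notation "A `<~` B" := (sub_mod0 mu A B) (at level 70).
Local Notation F := (cl_independent mu cl).

Let mcl A : measurable A -> measurable (cl A).
Proof. by case: clA => -[+ _] _; exact. Qed.

Let sub_cl A : measurable A -> A `<~` cl A.
Proof. by case: clA => _ [+ _ _ _ _]; exact. Qed.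

Let cl_mono A B : measurable A -> measurable B -> A `<~` B -> cl A `<~` cl B.
Proof. by case: clA => _ [_ + _ _ _]; exact. Qed.

Let cl_idem A : measurable A -> cl (cl A) `<~` cl A.
Proof.
move=> mA; case: clA => _ [_ _ /(_ A mA) + _ _].
by case/(eq_mod0_sub mu (mcl (mcl mA)) (mcl mA)).
Qed.

Let cl_mass A X : F A -> measurable X -> A `<~` cl X -> (mass A <= mass X)%R.
Proof.
case: clA => _ [_ _ _ + _] FA mX AX => /(_ A X FA mX AX).
by rewrite !muE //; case: FA.
Qed.

Lemma sub_cl_trans X Y Z : measurable X -> measurable Y -> measurable Z ->
  X `<~` cl Y -> Y `<~` cl Z -> X `<~` cl Z.
Proof.
move=> mX mY mZ XY YZ; have [mcY mcZ] := (mcl mY, mcl mZ).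
apply: (sub_mod0_trans mX mcY mcZ XY).
apply: (sub_mod0_trans mcY (mcl mcZ) mcZ); last exact: cl_idem.
exact: cl_mono.
Qed.

Lemma cl_independent_sub A B : measurable A -> A `<~` B -> F B -> F A.
Proof.
move=> mA AB [mB indB]; split=> // X mX XA X0.
have := indB X mX (sub_mod0_trans mX mA mB XA AB) X0.
have mAX : measurable (A `\` X) by solve_measurable.
have mBX : measurable (B `\` X) by solve_measurable.
have [mcA mcB] := (mcl mAX, mcl mBX).
rewrite !lt0e !measure_ge0 !andbT; apply: contra_neq => XcA.
apply: (sub_mod0_trans mX mcA mcB XcA); apply: cl_mono => //.
move: AB; rewrite !sub_mod0_ae //.
by apply: filterS => x h [Ax nX]; split=> //; exact: h.
Qed.

Lemma cl_independent_mod0 : mod0_family mu F.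
Proof.
split=> [A [//]|A B mA mB /eq_mod0_sub[]// _ BA].
exact: cl_independent_sub.
Qed.

Lemma cl_independent_I1 : I1 F.
Proof.
split=> // X mX; rewrite /sub_mod0 setD0 => ->.
by rewrite ltxx.
Qed.

(** If a non-null part of [X] lay outside [cl B], CL5 would enlarge [B] inside
    [X]. *)
Lemma basis_spans X B : measurable X -> maximal_in mu (restr mu F X) B ->
  X `<~` cl B.
Proof.
move=> mX [[FB BX] maxB]; have mB : measurable B by case: FB.
have mcB := mcl mB; have mD : measurable (X `\` cl B) by solve_measurable.
apply: contrapT => /eqP nX.
have D0 : 0 < mu (X `\` cl B) by rewrite lt0e nX /=.
case: clA => _ [_ _ _ _ /(_ B X FB mX D0)[H [mH HD H0 FBH]]].
have mU := measurableU _ _ mB mH.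
have UB : B `|` H `<~` B.
  apply: maxB; last by apply: subset_sub_mod0 => x; left.
  split=> //; move: BX HD; rewrite !sub_mod0_ae //.
  by apply: filterS2 => x hB hH [/hB//|/hH[]].
have : H `<~` set0.
  move: UB HD (sub_cl mB); rewrite !sub_mod0_ae // => h1 h2 h3.
  apply: filterS3 h1 h2 h3 => x /=; rewrite /setU /setD /=; tauto.
by rewrite /sub_mod0 setD0 => H00; move: H0; rewrite H00 ltxx.
Qed.

Lemma cl_independent_I3 : I3 mu F.
Proof.
move=> X A B mX maxA maxB.
have [[FA AX] _] := maxA; have [[FB BX] _] := maxB.
have [mA mB] : measurable A /\ measurable B by case: FA; case: FB.
have [mcA mcB] := (mcl mA, mcl mB).
rewrite !muE //; congr (_%:E); apply/eqP; rewrite eq_le.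
by rewrite !cl_mass //; apply: sub_mod0_trans (basis_spans mX _).
Qed.

(** If a non-null [X] were spanned by [U `\` X], then CL4 would give
    [mass (An n) <= mass (U `\` X)], which is less than the limit [mass U]. *)
Lemma cl_independent_I4 : I4 mu F.
Proof.
move=> An FA sA; have mA n : measurable (An n) by case: (FA n).
set U := \bigcup_n An n; have mU : measurable U by solve_measurable.
split=> // X mX XU X0.
have mD : measurable (U `\` X) by solve_measurable.
have mcD := mcl mD; rewrite lt0e measure_ge0 andbT.
apply/eqP; rewrite -/(sub_mod0 mu X _) => XcD.
have UcD : U `<~` cl (U `\` X).
  have := sub_cl mD; move: XcD; rewrite !sub_mod0_ae // => h1 h2.
  apply: filterS2 h1 h2 => x /=; rewrite /setD /=.
  by have [] := pselect (X x); tauto.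
have : (mass U <= mass (U `\` X))%R.
  apply: mass_bigcup_le => // n; apply: cl_mass => //.
  apply: sub_mod0_trans UcD => //.
  by apply: subset_sub_mod0; exact: bigcup_sup.
have := mass_split mu mU mX; suff : (0 < mass (U `&` X))%R by lra.
suff <- : mass X = mass (U `&` X) by rewrite -lte_fin -muE.
have mI : measurable (U `&` X) by solve_measurable.
apply: eq_mod0_mass => //; apply/eq_mod0_sub => //; split.
  move: XU; rewrite !sub_mod0_ae //.
  by apply: filterS => x h Xx; split=> //; exact: h.
by apply: subset_sub_mod0 => x [].
Qed.

Lemma cl_independence_axioms : independence_axioms mu F.
Proof.
split; first exact: cl_independent_mod0.
split; [exact: cl_independent_I1|move=> A B; exact: cl_independent_sub
  |exact: cl_independent_I3|exact: cl_independent_I4].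
Qed.

(** A basis [B] of [X] is also a maximal independent subset of the matroid
    closure of [X], since the two have the same rank, so [cl B] contains that
    closure.  In the other direction [cl X] is spanned by [B], so CL4 bounds its
    rank by that of [X]. *)
Lemma matroid_cl_recovers X : measurable X ->
  eq_mod0 mu (matroid_cl mu F X) (cl X).
Proof.
have indF := cl_independence_axioms; move=> mX; have mcX := mcl mX.
have mC := matroid_cl_measurable indF mX.
have [B maxB] := basis_exists indF mX.
have rB := rk_basis indF mX maxB; have XB := basis_spans mX maxB.
have [[FB BX] _] := maxB; have mB : measurable B by case: FB.
apply/eq_mod0_sub => //; split.
  have BC : B `<~` matroid_cl mu F X.
    exact: sub_mod0_trans (sub_matroid_cl indF mX).
  apply: (sub_cl_trans mC mB mX); last first.
    exact: sub_mod0_trans (sub_cl mX).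
  apply: basis_spans => //; split=> // Y [FY YC] BY.
  have mY : measurable Y by case: FY.
  apply: (sub_mod0_rigid mB mY BY); rewrite -rB -(rk_matroid_cl indF mX).
  exact: mass_le_rk.
have XcX := sub_cl mX.
apply: (same_rank_max_unique indF mX (matroid_clP indF mX)).
apply/same_rankP => //.
have [G maxG] := basis_exists indF mcX.
rewrite (rk_basis indF mcX maxG) rB; case: maxG => -[FG GX] _.
apply: cl_mass => //; apply: (sub_cl_trans _ mX mB GX XB).
by case: FG.
Qed.

End ClosureToMatroid.

Theorem theorem2p22 (R : realType) (d : measure_display)
    (J : measurableType d) (mu : {finite_measure set J -> \bar R}) :
  (forall F : set (set J),
     measurable_matroid mu F -> closure_axioms mu (matroid_cl mu F)) /\
  (forall cl : set J -> set J,
     standard_measure_space mu -> closure_axioms mu cl ->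
     [/\ independence_axioms mu (cl_independent mu cl),
         measurable_matroid mu (cl_independent mu cl) &
         forall X : set J, measurable X ->
           eq_mod0 mu (matroid_cl mu (cl_independent mu cl) X) (cl X)]).
Proof.
split=> [F [_ indF]|cl std clA]; first exact: matroid_closure_axioms.
have indF := cl_independence_axioms clA.
by split=> // X; exact: matroid_cl_recovers.
Qed.
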